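(* The inequality $\sum_{Q\subseteq[1,n]}L_Q(P)\ge0$ (or, equivalently, $f_\emptyset(P)\ge0$) determines a facet of the closed cone of $L$-vectors of Eulerian posets of rank $n+1$.
   Context: $[1,n]=\{1,\dots,n\}$. A graded poset is a finite partially ordered set $P$ with a unique minimum $\hat 0$, a unique maximum $\hat 1$, and a rank function $\rho:P\to\mathbf{N}$ with $\rho(\hat 0)=0$ and $\rho(y)-\rho(x)=1$ whenever $y$ covers $x$; its rank is $\rho(\hat 1)$. For $P$ of rank $n+1$ and $S\subseteq[1,n]$, $f_S(P)$ is the number of chains $x_1<\cdots<x_{|S|}$ in $P$ with $\{\rho(x_1),\dots,\rho(x_{|S|})\}=S$. $P$ is Eulerian if $\mu([x,y])=(-1)^{\rho(y)-\rho(x)}$ for every interval $[x,y]$ of $P$, where $\mu$ is the Möbius function. The flag $L$-vector of $P$ is $(L_S(P):S\subseteq[1,n])\in\mathbf R^{2^n}$, where $$L_S(P)=(-1)^{n-|S|}\sum_{T\supseteq[1,n]\setminus S}\left(-\tfrac12\right)^{|T|}f_T(P).$$ The closed cone of $L$-vectors of Eulerian posets of rank $n+1$ is the closure of the convex cone generated by all such $L$-vectors; its dimension is the number of even subsets of $[1,n]$ (subsets all of whose maximal intervals have even length). A linear inequality determines a facet if it is valid on the cone and the points where equality holds form a face of dimension one less than that of the cone. *)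

(* Defs.v *)
From HB Require Import structures.
From mathcomp Require Import all_boot all_order all_algebra.
From mathcomp Require Import all_classical all_reals all_analysis.

Set Implicit Arguments.
Unset Strict Implicit.
Unset Printing Implicit Defensive.

Import Order.TTheory GRing.Theory Num.Theory.
Import numFieldNormedType.Exports.

Local Open Scope ring_scope.
Local Open Scope classical_set_scope.

Section Posets.
Context {disp : Order.disp_t} {P : finTBPOrderType disp}.
Implicit Types (x y z : P) (rho : P -> nat).

Definition covers y x : bool :=
  (x < y)%O && [forall z, ~~ (x < z < y)%O].

Definition graded rho (r : nat) : Prop :=
  [/\ rho \bot%O = 0%N,
      (forall x y, covers y x -> rho y = (rho x).+1) &
      rho \top%O = r].

(* The fuel #|P| is large enough: see mobiusE. *)
Fixpoint mobius_rec (k : nat) x y : int :=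
  if k is k'.+1 then
    if x == y then 1 else - \sum_(z | (x <= z < y)%O) mobius_rec k' x z
  else 0.

Definition mobius x y : int := mobius_rec #|P| x y.

Lemma mobius_rec_fuel k k' x y :
  (#|[set z | (x <= z <= y)%O]%SET| <= k)%N ->
  (#|[set z | (x <= z <= y)%O]%SET| <= k')%N ->
  mobius_rec k x y = mobius_rec k' x y.
Proof.
have out m u v : ~~ (u <= v)%O -> mobius_rec m u v = 0.
  case: m => [//|m] /= nuv; have [uv|_] := eqVneq u v.
    by rewrite uv lexx in nuv.
  rewrite big1 ?oppr0// => z /andP[uz zv].
  by rewrite (le_trans uz (ltW zv)) in nuv.
have [xy|nxy] := boolP (x <= y)%O; last by rewrite !out.
have pos v : (x <= v)%O -> (#|[set z | (x <= z <= v)%O]%SET| <= 0)%N = false.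
  move=> xv; rewrite leqNgt; apply/negbTE; rewrite negbK.
  by apply/card_gt0P; exists x; rewrite finset.inE lexx xv.
elim: k k' y xy => [|k IH] [|k'] y xy; rewrite ?pos// => hk hk' /=.
case: eqVneq => // _; congr (- _).
apply: eq_bigr => z /andP[xz zy].
have lt : (#|[set t | (x <= t <= z)%O]%SET| < #|[set t | (x <= t <= y)%O]%SET|)%N.
  apply: proper_card; apply/properP; split.
    apply/fintype.subsetP => t; rewrite !finset.inE => /andP[-> tz] /=.
    exact: le_trans tz (ltW zy).
  by exists y; rewrite !finset.inE ?xy ?lexx ?(lt_geF zy)//.
by apply: IH => //; rewrite -ltnS; apply: leq_trans lt _.
Qed.

Lemma mobiusE x y :
  mobius x y = if x == y then 1 else - \sum_(z | (x <= z < y)%O) mobius x z.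
Proof.
have -> : mobius x y = mobius_rec #|P|.+1 x y.
  by apply: mobius_rec_fuel; rewrite ?max_card// ltnW// ltnS max_card.
by [].
Qed.

Definition eulerian rho : Prop :=
  forall x y, (x <= y)%O -> mobius x y = (-1) ^+ (rho y - rho x).

(* In all that follows an element i of 'I_n stands for the element i + 1 of
   [1,n]. *)
Definition flagf n rho (S : {set 'I_n}) : nat :=
  #|[set x : #|S|.-tuple P | sorted <%O x &
      `[< map rho x =i [seq (val i).+1 | i in S] >]]%SET|.

Definition flagL (R : realType) n rho (S : {set 'I_n}) : R :=
  (-1) ^+ (n - #|S|) *
  \sum_(T : {set 'I_n} | ~: S \subset T) (- 2^-1) ^+ #|T| * (flagf rho T)%:R.

End Posets.

Section Cones.
Context {R : realType}.

Definition cone_hull {V : lmodType R} (G : set V) : set V :=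
  [set x | exists (k : nat) (c : 'I_k -> R) (g : 'I_k -> V),
     [/\ (forall i, 0 <= c i), (forall i, G (g i)) &
         x = \sum_(i < k) c i *: g i]].

(* The dimension of the affine hull: x0 + U is the smallest affine subspace
   containing A. *)
Definition has_dim {V : vectType R} (A : set V) (d : nat) : Prop :=
  exists (x0 : V) (U : {vspace V}),
    [/\ A x0, (forall x, A x -> x - x0 \in U),
        (forall W : {vspace V}, (forall x, A x -> x - x0 \in W) ->
           (U <= W)%VS) & \dim U = d].

(* l stands for the linear inequality 0 <= l x. *)
Definition determines_facet {V : vectType R} (C : set V)
    (l : {linear V -> R^o}) : Prop :=
  (forall x, C x -> 0 <= l x) /\
  exists d : nat, has_dim C d.+1 /\ has_dim (C `&` [set x | l x = 0]) d.

End Cones.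

Section LVectors.
Context {R : realType} (n : nat).

(* R^(2^n): its coordinates are indexed by the subsets of [1,n]
   via enum_rank and enum_val. *)
Notation flag_space := 'rV[R]_#|{: {set 'I_n}}|.

Definition flagL_vec {disp : Order.disp_t} {P : finTBPOrderType disp}
    (rho : P -> nat) : flag_space :=
  \row_i flagL R rho (enum_val i).

Definition eulerian_flagL_vecs : set flag_space :=
  [set v | exists (disp : Order.disp_t) (P : finTBPOrderType disp)
     (rho : P -> nat),
     [/\ graded rho n.+1, eulerian rho & v = flagL_vec rho]].

Definition eulerian_cone : set flag_space :=
  closure (cone_hull eulerian_flagL_vecs : set flag_space).

Definition coord_sum (v : flag_space) : R^o :=
  \sum_(Q : {set 'I_n}) v ord0 (enum_rank Q).

Lemma coord_sum_is_linear : linear coord_sum.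
Proof.
move=> a u v; rewrite /coord_sum scaler_sumr -big_split /=.
by apply: eq_bigr => Q _; rewrite !mxE.
Qed.

HB.instance Definition _ :=
  GRing.isLinear.Build R flag_space R^o *:%R coord_sum coord_sum_is_linear.

End LVectors.

Arguments eulerian_flagL_vecs : clear implicits.
Arguments eulerian_cone : clear implicits.
Arguments coord_sum : clear implicits.

(* Main.v *)
(** The coordinate sum of every L-vector is f_emptyset = 1, so L-vectors of
    Eulerian posets lie in the hyperplane [coord_sum = 1] and the facet can
    only be seen in the closure. Given an Eulerian poset P of rank n+1, glue
    N+1 copies of P along its minimum, its maximum and, when n is odd, two
    fixed atoms (found below an element of rank 2). The Euler characteristics
    match, so the result G_N is again Eulerian, and L(G_N) = (N+1) L(P) - N c
    where the vector c comes from the flags inside the glued part and depends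
    only on n. Hence L(G_N)/(N+1) tends to L(P) - c, a point of the closed
    cone with coordinate sum 0. The differences of the vectors L(P) - c are
    all the differences L(P) - L(P'), and these span a hyperplane of the span
    of the cone. *)

Require Import Defs.
From HB Require Import structures.
From mathcomp Require Import all_boot all_order all_algebra.
From mathcomp Require Import all_classical all_reals all_analysis.

Set Implicit Arguments.
Unset Strict Implicit.
Unset Printing Implicit Defensive.

Import Order.TTheory GRing.Theory Num.Theory.

Local Open Scope ring_scope.

(** * Rank functions and the Eulerian condition *)

Section Rank.
Context {disp : Order.disp_t} {P : finTBPOrderType disp}.
Context (rho : P -> nat) (r : nat) (gr : graded rho r).
Implicit Types x y z : P.

(** The rank axioms speak only of covers, so the proof is an induction on the number of points
    strictly between [x] and [y], splitting at one of them. *)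
Lemma graded_lt x y : (x < y)%O -> (rho x < rho y)%N.
Proof.
have [_ gcov _] := gr; have [m] := ubnP #|[pred z | (x < z < y)%O]|.
elim: m x y => // m IH x y; rewrite ltnS => lem xy.
have [cov|] := boolP (covers y x); first by rewrite (gcov _ _ cov).
rewrite /covers xy negb_forall => /existsP[z]; rewrite negbK => /andP[xz zy].
(* One claim for both halves: [z] is an endpoint of the smaller interval, hence no longer strictly
   inside it, and the count drops. *)
have IHm u v : (x <= u)%O -> (v <= y)%O -> (u < v)%O -> (u == z) || (v == z) ->
    (rho u < rho v)%N.
  move=> xu vy uv uvz; apply: IH => //; apply: leq_trans lem; apply: proper_card.
  apply/properP; split.
    apply/fintype.subsetP => t; rewrite !inE => /andP[ut tv].
    by rewrite (le_lt_trans xu ut) (lt_le_trans tv vy).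
  by exists z; rewrite !inE ?xz//; case/orP: uvz => /eqP->; rewrite ltxx ?andbF.
by apply: ltn_trans (IHm x z _ _ _ _) (IHm z y _ _ _ _);
  rewrite ?lexx ?eqxx ?orbT ?ltW.
Qed.

Lemma graded_le x y : (x <= y)%O -> (rho x <= rho y)%N.
Proof. by rewrite le_eqVlt => /predU1P[->//|/graded_lt/ltnW]. Qed.

Lemma graded_eq0 x : (rho x == 0%N) = (x == \bot%O).
Proof.
have [g0 _ _] := gr; apply/eqP/eqP => [rx|->//]; apply/eqP/negPn/negP.
by rewrite -lt0x => /graded_lt; rewrite rx.
Qed.

Lemma graded_eq_top x : (rho x == r) = (x == \top%O).
Proof.
have [_ _ g1] := gr; apply/eqP/eqP => [rx|->//]; apply/eqP/negPn/negP.
by rewrite -ltx1 => /graded_lt; rewrite rx g1 ltnn.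
Qed.

(** Descend from [y] one rank at a time: an element of maximal rank among those strictly below [y]
    is covered by [y]. *)
Lemma exists_rank_below k y : (k <= rho y)%N -> exists2 x, (x <= y)%O & rho x = k.
Proof.
have [_ gcov _] := gr; have [m] := ubnP (rho y).
elim: m y => // m IH y; rewrite ltnS => ym.
rewrite leq_eqVlt => /predU1P[->|ky]; first by exists y.
have b_lt_y : (\bot < y)%O.
  by rewrite lt0x -graded_eq0 -lt0n (leq_ltn_trans _ ky).
have [x xy xmax] := @arg_maxnP _ \bot%O (fun x => x < y)%O rho b_lt_y.
have cov : covers y x.
  rewrite /covers xy; apply/forallP => z; apply/negP => /andP[xz zy].
  by have := leq_trans (graded_lt xz) (xmax _ zy); rewrite ltnn.
rewrite (gcov _ _ cov) ltnS in ym ky.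
have [z zx zk] := IH x ym ky.
by exists z => //; exact: le_trans zx (ltW xy).
Qed.

Lemma sum_closed_interval (V : nmodType) (F : P -> V) x y : (x <= y)%O ->
  \sum_(z | (x <= z <= y)%O) F z = F y + \sum_(z | (x <= z < y)%O) F z.
Proof.
move=> xy; rewrite (bigD1 y) ?xy ?lexx//=; congr (_ + _).
by apply: eq_bigl => z; rewrite -andbA lt_neqAle [(_ <= y)%O && _]andbC.
Qed.

(** Up to the constant sign of [rho x], the vanishing of the alternating sum is the Möbius
    recurrence for the values prescribed by [eulerian]. This form avoids both [mobius] and truncated
    subtraction. *)
Lemma eulerianP : eulerian rho <->
  forall x y, (x < y)%O -> \sum_(z | (x <= z <= y)%O) (-1) ^+ rho z = 0 :> int.
Proof.
have shift x z : (x <= z)%O ->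
    (-1) ^+ (rho z - rho x) = (-1) ^+ rho x * (-1) ^+ rho z :> int.
  by move=> /graded_le xz; rewrite -{2}(subnK xz) exprD mulrCA -expr2 sqrr_sign mulr1.
split=> [eu x y xy|alt x].
  have := mobiusE x y; rewrite (lt_eqF xy) => /eqP; rewrite -addr_eq0.
  rewrite -sum_closed_interval ?ltW// => /eqP sum0.
  apply: (mulfI (negbT (signr_eq0 _ (rho x)))); rewrite mulr0 -{}[RHS]sum0 mulr_sumr.
  by apply: eq_bigr => z /andP[xz zy]; rewrite eu// shift.
move=> y; have [m] := ubnP (rho y); elim: m y => // m IH y; rewrite ltnS => ym xy.
rewrite mobiusE; case: eqVneq => [->|nxy]; first by rewrite subnn.
have x_lt_y : (x < y)%O by rewrite lt_neqAle nxy.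
rewrite shift//; apply/esym/eqP; rewrite -addr_eq0; apply/eqP.
transitivity ((-1) ^+ rho x * \sum_(z | (x <= z <= y)%O) (-1) ^+ rho z : int).
  rewrite sum_closed_interval// mulrDr; congr (_ + _); rewrite mulr_sumr.
  apply: eq_bigr => z /andP[xz zy]; rewrite -shift// IH// (leq_trans _ ym)//.
  exact: graded_lt.
by rewrite alt// mulr0.
Qed.

End Rank.

(** * Gluing copies of a poset *)

(* A down-set together with the maximum: this shape is what makes the glued
   relation transitive. *)
Record gluing_set {disp : Order.disp_t} (P : finTBPOrderType disp) := GluingSet {
  gluing_set_val :> {set P};
  gluing_bot : \bot%O \in gluing_set_val;
  gluing_top : \top%O \in gluing_set_val;
  gluing_down : forall x y, (x <= y)%O -> (y < \top)%O ->
    y \in gluing_set_val -> x \in gluing_set_val }.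

(* N + 1 copies of P; the points of K, common to all copies, are represented by
   their occurrence in copy 0. *)
Definition glued {disp : Order.disp_t} {P : finTBPOrderType disp}
    (K : gluing_set P) (N : nat) :=
  {u : 'I_N.+1 * P | (u.2 \in K) ==> (u.1 == ord0)}.

Section Glued.
Context {disp : Order.disp_t} {P : finTBPOrderType disp}.
Context (K : gluing_set P) (N : nat).
Local Notation G := (glued K N).
Implicit Types (u v w : G) (i j k : 'I_N.+1) (x y z : P).

HB.instance Definition _ := Finite.on G.

Definition glued_base u : P := (val u).2.

Lemma copy_pt_subproof i x : (x \in K) ==> ((if x \in K then ord0 else i) == ord0).
Proof. by case: (x \in K). Qed.

(** On [K] the index is reset to 0, so [i] is irrelevant there and every pair names a point of the
    glued poset. *)
Definition copy_pt i x : G :=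
  Sub (if x \in K then ord0 else i, x) (copy_pt_subproof i x).

Lemma copy_ptK i : cancel (copy_pt i) glued_base. Proof. by []. Qed.

Lemma eq_copy_pt i j x y :
  (copy_pt i x == copy_pt j y) = (x == y) && ((x \in K) || (i == j)).
Proof.
rewrite -val_eqE /= xpair_eqE andbC; case: eqVneq => //= ->.
by case: (y \in K); rewrite ?eqxx.
Qed.

Lemma gluedP u : u = copy_pt (val u).1 (glued_base u).
Proof.
apply: val_inj; case: u => -[i x] ux; rewrite /glued_base /=.
by case: (boolP (x \in K)) (implyP ux) => // _ /(_ isT)/eqP /= ->.
Qed.

Definition glued_le u v : bool := (glued_base u <= glued_base v)%O &&
  [|| (val u).1 == (val v).1, glued_base u \in K | glued_base v \in K].

Lemma glued_le_copy_pt i j x y : glued_le (copy_pt i x) (copy_pt j y) =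
  (x <= y)%O && [|| i == j, x \in K | y \in K].
Proof.
rewrite /glued_le /glued_base /=; congr (_ && _).
by case: (x \in K); case: (y \in K); rewrite ?orbT.
Qed.

Lemma glued_le_refl : reflexive glued_le.
Proof. by move=> u; rewrite /glued_le lexx eqxx. Qed.

Lemma glued_le_anti : antisymmetric glued_le.
Proof.
move=> u v; rewrite (gluedP u) (gluedP v) !glued_le_copy_pt.
move=> /andP[/andP[xy c] /andP[yx _]].
have /eqP xE : glued_base u == glued_base v by rewrite eq_le xy yx.
apply/eqP; rewrite eq_copy_pt xE eqxx /=.
by move: c; rewrite xE orbb orbC.
Qed.

Lemma glued_le_trans : transitive glued_le.
Proof.
move=> v u w; rewrite (gluedP u) (gluedP v) (gluedP w) !glued_le_copy_pt.
move: (val u).1 (val v).1 (val w).1 (glued_base u) (glued_base v) (glued_base w).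
move=> i j k x y z /andP[xy cxy] /andP[yz cyz]; rewrite (le_trans xy yz) /=.
case: (boolP (x \in K)) cxy => [|nx]; rewrite ?orbT//=.
case: (boolP (z \in K)) cyz => [|nz]; rewrite ?orbT//= !orbF.
(* With [x] and [z] outside [K], a shared [y] is impossible: below the maximum it forces [x] into
   [K], and if it is the maximum then so is [z]. *)
case: (boolP (y \in K)) => [yK _ _|_]; rewrite ?orbF; last by move=> /eqP-> /eqP->.
have [y_lt|] := boolP (y < \top)%O.
  by rewrite (gluing_down xy y_lt yK) in nx.
rewrite ltx1 negbK => /eqP y1; rewrite y1 le1x in yz.
by rewrite (eqP yz) gluing_top in nz.
Qed.

HB.instance Definition _ := Order.Le_isPOrder.Build disp G
  glued_le_refl glued_le_anti glued_le_trans.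

Lemma glued_le0 u : (copy_pt ord0 \bot <= u)%O.
Proof.
have : glued_le (copy_pt ord0 \bot%O) u.
  by rewrite [u]gluedP glued_le_copy_pt le0x gluing_bot orbT.
by [].
Qed.

Lemma glued_le1 u : (u <= copy_pt ord0 \top)%O.
Proof.
have : glued_le u (copy_pt ord0 \top%O).
  by rewrite [u]gluedP glued_le_copy_pt lex1 gluing_top !orbT.
by [].
Qed.

HB.instance Definition _ := Order.hasBottom.Build disp G glued_le0.
HB.instance Definition _ := Order.hasTop.Build disp G glued_le1.

Lemma le_copy_pt i j x y :
  (copy_pt i x <= copy_pt j y)%O = (x <= y)%O && [|| i == j, x \in K | y \in K].
Proof. exact: glued_le_copy_pt. Qed.

Lemma lt_copy_pt i j x y :
  (copy_pt i x < copy_pt j y)%O = (x < y)%O && [|| i == j, x \in K | y \in K].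
Proof.
rewrite !lt_neqAle le_copy_pt eq_copy_pt; case: eqVneq => //= <-.
by rewrite lexx orbb /= orbC andNb.
Qed.

Lemma lt_copy_pt1 i : {mono copy_pt i : x y / (x < y)%O}.
Proof. by move=> x y; rewrite lt_copy_pt eqxx andbT. Qed.

Lemma sum_glued (V : nmodType) (F : G -> V) :
  \sum_u F u =
  \sum_(x in K) F (copy_pt ord0 x) + \sum_i \sum_(x | x \notin K) F (copy_pt i x).
Proof.
rewrite pair_big /=.
rewrite (bigID (fun u => glued_base u \in K)) /=; congr (_ + _).
- rewrite [RHS](reindex_onto glued_base (copy_pt ord0)) => [|x _]; last exact: copy_ptK.
  apply: eq_big => u.
    case: (boolP (_ \in K)) => //= uK.
    by rewrite [X in _ == X]gluedP eq_copy_pt eqxx uK.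
  by move=> uK; congr F; apply/eqP; rewrite [X in X == _]gluedP eq_copy_pt uK eqxx.
- rewrite [RHS](reindex_onto val (fun p => copy_pt p.1 p.2)); last first.
    by move=> [i x] /= /negbTE ->.
  apply: eq_big => u; last by move=> _; rewrite -gluedP.
  by rewrite -gluedP eqxx andbT.
Qed.

Lemma glued_interval i j k x y z : (x \notin K) || (y < \top)%O ->
  (x < y)%O -> [|| i == j, x \in K | y \in K] ->
  (copy_pt i x <= copy_pt k z <= copy_pt j y)%O =
  (x <= z <= y)%O && ((z \in K) || (k == if x \in K then j else i)).
Proof.
move=> exc xy cxy; rewrite !le_copy_pt andbACA.
case: (boolP (x <= z <= y)%O) => //= /andP[xz zy].
case: (boolP (z \in K)) => zK; first by rewrite !orbT.
case: (boolP (x \in K)) exc cxy => [xK /= y1 _|nxK _]; last first.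
  case: (boolP (y \in K)) => /= [_ _|_]; rewrite ?orbT ?orbF ?andbT.
    by rewrite eq_sym.
  by move/eqP=> <-; rewrite eq_sym andbb.
have -> : y \in K = false.
  by apply: contraNF zK => yK; exact: gluing_down zy y1 yK.
by rewrite orbT !orbF.
Qed.

Variable rho : P -> nat.

Definition glued_rho u : nat := rho (glued_base u).

Lemma glued_graded r : graded rho r -> graded glued_rho r.
Proof.
move=> gr; have [g0 gcov g1] := gr; split => // u v.
rewrite (gluedP u) (gluedP v).
move: (val u).1 (val v).1 (glued_base u) (glued_base v) => i j x y.
rewrite /covers lt_copy_pt => /andP[/andP[yx c] /forallP nobetween].
apply: gcov; rewrite /covers yx; apply/forallP => z; apply/negP => /andP[yz zx].
(* The point between is lifted to a copy where it compares with both ends: that of the upper end if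
   the lower one is shared, else that of the lower end. *)
have /negP := nobetween (copy_pt (if y \in K then i else j) z); apply.
rewrite !lt_copy_pt yz zx /=.
case: (boolP (y \in K)) c => [_ _|nyK]; first by rewrite eqxx !orbT.
by rewrite eqxx /= orbF => /orP[/eqP->|->]; rewrite ?eqxx ?orbT.
Qed.

(* An interval of the glued poset is an interval of P, except for those from a
   point of K to the maximum: there the sum is N + 1 times that over P, minus N
   times that over K. *)
Lemma glued_eulerian r : graded rho r -> eulerian rho ->
  (forall x, x \in K -> (x < \top)%O ->
     \sum_(z in K | (x <= z)%O) (-1) ^+ rho z = 0 :> int) ->
  eulerian glued_rho.
Proof.
move=> gr /(eulerianP gr) alt altK; apply/(eulerianP (glued_graded gr)) => u v.
rewrite (gluedP u) (gluedP v).
move: (val u).1 (val v).1 (glued_base u) (glued_base v) => i j x y.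
rewrite lt_copy_pt => /andP[xy c].
have [exc|] := boolP ((x \notin K) || (y < \top)%O); last first.
  rewrite negb_or negbK => /andP[xK]; rewrite ltx1 negbK => /eqP y1.
  move: xy; rewrite {c}y1 => xy; rewrite big_mkcond sum_glued -!big_mkcondr /=.
  have intv k z : (copy_pt i x <= copy_pt k z <= copy_pt j \top)%O = (x <= z)%O.
    by rewrite !le_copy_pt lex1 xK gluing_top !orbT !andbT.
  under eq_bigl do rewrite intv.
  rewrite altK// add0r big1// => k _; rewrite -big_mkcondr /=.
  under eq_bigl do rewrite intv.
  have s0 : \sum_(z | (x <= z)%O) (-1) ^+ rho z = 0 :> int.
    by rewrite -[RHS](alt _ _ xy); apply: eq_bigl => z; rewrite lex1 andbT.
  rewrite -[RHS]s0 [RHS](bigID (mem K)) /=.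
  under [X in _ = X + _]eq_bigl do rewrite andbC.
  by rewrite altK// add0r; apply: eq_bigl => z; rewrite andbC.
(* [k] is the only copy met outside [K], so [copy_pt k] identifies the interval with one of [P]. *)
rewrite -[RHS](alt _ _ xy); set k := if x \in K then j else i.
rewrite [LHS](reindex_onto (copy_pt k) glued_base) /=; last first.
  move=> w; rewrite (gluedP w); move: (val w).1 (glued_base w) => l z.
  rewrite glued_interval// copy_ptK => /andP[_ zl].
  by apply/eqP; rewrite eq_copy_pt eqxx eq_sym.
apply: eq_bigl => z; rewrite copy_ptK eqxx andbT glued_interval//.
by rewrite eqxx orbT andbT.
Qed.

End Glued.

Arguments glued_base {disp P K N} u.
Arguments copy_pt {disp P} K {N} i x.
Arguments glued_rho {disp P} K N rho u.

(** * Counting flags *)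

Definition flag_chain {disp : Order.disp_t} {P : finTBPOrderType disp} n
    (rho : P -> nat) (S : {set 'I_n}) (t : seq P) : bool :=
  sorted <%O t && `[< map rho t =i [seq (val i).+1 | i in S] >].

Lemma flagfE {disp : Order.disp_t} {P : finTBPOrderType disp} n
    (rho : P -> nat) (S : {set 'I_n}) :
  flagf rho S = #|[pred t : #|S|.-tuple P | flag_chain rho S t]|.
Proof. by rewrite /flagf cardsE. Qed.

Lemma flagf_set0 {disp : Order.disp_t} {P : finTBPOrderType disp} n (rho : P -> nat) :
  flagf rho (finset.set0 : {set 'I_n}) = 1%N.
Proof.
rewrite flagfE; transitivity #|{: #|(finset.set0 : {set 'I_n})|.-tuple P}|.
  apply: eq_card => t; rewrite !inE /flag_chain.
  have t0 : val t = [::] by apply: size0nil; rewrite size_tuple cards0.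
  rewrite t0 /=; apply/asboolP => a; rewrite in_nil; apply/esym/negbTE/negP.
  by move=> /mapP[i]; rewrite mem_enum inE.
by rewrite card_tuple cards0.
Qed.

Section FlagsGlued.
Context {disp : Order.disp_t} {P : finTBPOrderType disp}.
Context (K : gluing_set P) (N : nat) (rho : P -> nat) (n : nat) (S : {set 'I_n}).
Local Notation G := (glued K N).

Lemma flag_chain_copy_pt i (t : seq P) :
  flag_chain (glued_rho K N rho) S (map (copy_pt K i) t) = flag_chain rho S t.
Proof.
rewrite /flag_chain -map_comp sorted_map.
by congr (_ && _); apply: eq_sorted; exact: lt_copy_pt1.
Qed.

(** A point outside [K] compares only with its own copy and with [K], so it fixes the copy of every
    chain through it; for a chain inside [K] any index will do. *)
Lemma flag_chain_copy_ptE (w : seq G) i x : sorted <%O w ->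
  all (mem K) (map glued_base w) \/ (x \notin K) /\ copy_pt K i x \in w ->
  w = map (copy_pt K i) (map glued_base w).
Proof.
move=> ws hw; rewrite -map_comp -[LHS]map_id; apply/eq_in_map => u uw /=.
rewrite [LHS]gluedP; apply/eqP; rewrite eq_copy_pt eqxx /=.
case: hw => [/allP wK|[nxK xw]].
  by have /= -> := wK _ (map_f glued_base uw).
have : (copy_pt K i x >=< u)%O.
  have {}ws := sorted_ltn_nth lt_trans \bot%O ws.
  have [a aw <-] := nthP \bot%O xw; have [b bw <-] := nthP \bot%O uw.
  case: (ltngtP a b) => [ab|ba|->]; last by rewrite comparablexx.
    by rewrite lt_comparable// ws.
  by rewrite comparable_sym lt_comparable// ws.
rewrite {1}(gluedP u) /Order.comparable !le_copy_pt (negbTE nxK) /= orbF.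
by rewrite eq_sym => /orP[] /andP[_]; rewrite orbC.
Qed.

(* A chain leaving K lies in exactly one copy, a chain inside K in all of them. *)
Lemma flagf_glued :
  (flagf (glued_rho K N rho) S +
   N * #|[pred t : #|S|.-tuple P | flag_chain rho S t & all (mem K) t]| =
   N.+1 * flagf rho S)%N.
Proof.
pose proj (w : #|S|.-tuple G) := [tuple of map glued_base w].
pose lift (i : 'I_N.+1) (t : #|S|.-tuple P) : #|S|.-tuple G :=
  [tuple of map (copy_pt K i) t].
have liftK i : cancel (lift i) proj.
  by move=> t; apply: val_inj; rewrite /= -map_comp map_id_in.
have chain_lift i t : flag_chain (glued_rho K N rho) S (lift i t) = flag_chain rho S t.
  exact: flag_chain_copy_pt.
have chain_proj (w : #|S|.-tuple G) : flag_chain (glued_rho K N rho) S w ->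
    exists i, w = lift i (proj w).
  move=> /andP[ws _]; case: (boolP (all (mem K) (proj w))) => [wK|].
    (* The chain lies in every copy; [ord0] is an arbitrary choice, and [\bot] only fills an
       argument that the left alternative ignores. *)
    by exists ord0; apply/val_inj/(flag_chain_copy_ptE (x := \bot%O)) => //; left.
  rewrite all_map => /allPn[u uw nuK]; exists (val u).1; apply: val_inj.
  apply: (flag_chain_copy_ptE (x := glued_base u)) => //; right; split => //.
  by rewrite -gluedP.
pose chainG := [pred w : #|S|.-tuple G | flag_chain (glued_rho K N rho) S w].
pose chainP := [pred w : #|S|.-tuple P | flag_chain rho S w].
have -> : flagf (glued_rho K N rho) S = #|chainG| by rewrite flagfE.
(* Count by the fibres of the projection to [P]: one lift if [t] lies inside [K], [N.+1] lifts
   otherwise. *)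
have -> : #|chainG| =
    (\sum_(t in chainP) \sum_(w in chainG | proj w == t) 1)%N.
  transitivity (\sum_(w in chainG) 1)%N; first by rewrite sum1_card.
  apply: partition_big => w cw.
  by have [i wE] := chain_proj w cw; rewrite inE /= -(chain_lift i) -wE.
pose inK := [pred t : #|S|.-tuple P | all (mem K) t].
have -> : flagf rho S = (\sum_(t in chainP) 1)%N by rewrite sum1_card flagfE.
have -> : #|[pred t : #|S|.-tuple P | flag_chain rho S t & all (mem K) t]| =
    (\sum_(t in chainP | inK t) 1)%N.
  by rewrite sum1dep_card; apply: eq_card => t; rewrite !inE.
rewrite (bigID inK) [in RHS](bigID inK) /=.
rewrite mulnDr mulSn addnAC -!addnA.
congr (_ + (_ + _))%N.
- apply: eq_bigr => t /andP[ct tK].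
  rewrite (big_pred1 (lift ord0 t))// => w; apply/andP/eqP => [[cw /eqP wt]|->].
    have [i wE] := chain_proj w cw; rewrite wE wt; apply: val_inj => /=.
    apply/eq_in_map => x xt; apply/eqP; rewrite eq_copy_pt eqxx /=.
    by have /= -> := allP tK x xt.
  by rewrite inE chain_lift liftK.
- rewrite big_distrr; apply: eq_bigr => t /andP[ct ntK] /=.
  rewrite sum1dep_card muln1 -[RHS]card_ord -(card_codom (f := lift^~ t)).
    apply: eq_card => w; rewrite [LHS]inE; apply/andP/codomP => [[cw /eqP wt]|[i ->]].
      by have [i wE] := chain_proj w cw; exists i; rewrite wE wt.
    by rewrite inE chain_lift liftK.
  have /allPn[x xt /= /negbTE xK] := ntK.
  move=> i j /(congr1 val)/eq_in_map/(_ x xt)/eqP.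
  by rewrite eq_copy_pt eqxx xK => /eqP.
Qed.

End FlagsGlued.

(* The flag numbers of {bot, top} U B, where B is empty if n is even and
   consists of two atoms if n is odd. *)
Definition core_flagf n (S : {set 'I_n}) : nat :=
  if S == finset.set0 then 1%N
  else if S \subset [pred i | val i == 0%N] then (odd n).*2 else 0%N.

(** * The shared part: minimum, maximum and possibly two atoms *)

Section Core.
Context {disp : Order.disp_t} {P : finTBPOrderType disp}.
Context (n : nat) (rho : P -> nat) (gr : graded rho n.+1).

(** For odd [n] the maximum has rank at least 2, so some [y] has rank 2; the alternating sum from
    the minimum to [y] is 1 - a + 1, with a the number of atoms below [y], whence a = 2. *)
Lemma exists_core : eulerian rho ->
  exists B : {set P}, (forall x, x \in B -> rho x = 1%N) /\ #|B| = (odd n).*2.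
Proof.
move=> /(eulerianP gr) alt; have [g0 _ g1] := gr.
case: (boolP (odd n)) => no; last first.
  by exists finset.set0; rewrite cards0; split => // x; rewrite inE.
have n_gt0 : (0 < n)%N by case: (n) no.
have [|y _ ry] := @exists_rank_below _ _ _ _ gr 2 \top%O; first by rewrite g1.
have y_gt0 : (\bot < y)%O by rewrite lt0x -(graded_eq0 gr) ry.
have rk1 z : ((\bot <= z < y)%O && (z != \bot%O)) -> rho z = 1%N.
  rewrite -(graded_eq0 gr) => /andP[/andP[_ /(graded_lt gr)]]; rewrite ry.
  by case: (rho z) => [|[|]].
exists [set z | (\bot <= z < y)%O && (z != \bot%O)]%SET; split.
  by move=> z; rewrite inE => /rk1.
have := alt _ _ y_gt0; rewrite sum_closed_interval ?ltW// (bigD1 \bot%O) ?lexx//=.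
under eq_bigr do rewrite rk1//.
rewrite sumr_const ry g0 addrA expr1 mulNrn cardsE /=.
move=> /eqP; rewrite subr_eq0 => /eqP/(congr1 absz).
by rewrite /= natz.
Qed.

Context (B : {set P}) (rkB : forall x, x \in B -> rho x = 1%N).
Context (cardB : #|B| = (odd n).*2).

Lemma core_odd x : x \in B -> odd n.
Proof.
move=> xB; apply/negPn/negP => /negbTE ne.
by move: cardB xB; rewrite ne => /cards0_eq ->; rewrite inE.
Qed.

Lemma bot_notin_core : \bot%O \notin B.
Proof. by apply/negP => /rkB; have [-> _ _] := gr. Qed.

(** The maximum has rank 1 only for n = 0, which is even, and then [B] is empty. *)
Lemma top_notin_core : \top%O \notin B.
Proof.
apply/negP => tB; have := rkB tB; have [_ _ ->] := gr => -[n0].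
by have := core_odd tB; rewrite n0.
Qed.

Lemma core_down x y : (x <= y)%O -> (y < \top)%O ->
  y \in (\bot%O |: (\top%O |: B))%SET -> x \in (\bot%O |: (\top%O |: B))%SET.
Proof.
rewrite !inE => xy y1; rewrite (lt_eqF y1) /= => /orP[/eqP y0|yB].
  by move: xy; rewrite y0 lex0 => ->.
move: xy; rewrite le_eqVlt => /predU1P[->|/(graded_lt gr)]; first by rewrite yB !orbT.
by rewrite (rkB yB) ltnS leqn0 (graded_eq0 gr) => ->.
Qed.

Definition core : gluing_set P :=
  GluingSet (setU11 _ _) (setU1r _ (setU11 _ _)) core_down.

(** From the minimum the sum is 1 + (-1)^(n+1) - |B|, which dictates the size of [B]: 2 for odd [n]
    and 0 for even [n]. From an atom of [B], present only for odd [n], it is -1 + 1. *)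
Lemma core_alternating x : x \in core -> (x < \top)%O ->
  \sum_(z in core | (x <= z)%O) (-1) ^+ rho z = 0 :> int.
Proof.
have [g0 _ g1] := gr => xK x1; have n1 : \bot%O != \top%O :> P.
  by rewrite -(graded_eq_top gr) g0.
rewrite big_mkcondr /= big_setU1 ?inE ?(negbTE n1) ?bot_notin_core//=.
rewrite big_setU1 ?top_notin_core//= lex1 g0 g1.
move: xK; rewrite !inE (lt_eqF x1) /= => /orP[/eqP->|xB].
  under eq_bigr => z zB do rewrite le0x rkB//.
  rewrite lexx sumr_const cardB exprS -[in X in _ * X]signr_odd.
  by case: (odd n).
have /negbTE xn0 : x != \bot%O by apply: contraNneq bot_notin_core => <-.
rewrite lex0 xn0 add0r (bigD1 x)//= lexx big1 => [|z /andP[zB zx]].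
  by rewrite rkB// exprS -[in X in _ * X]signr_odd (core_odd xB).
case: ifP => // xz; have : (x < z)%O by rewrite lt_neqAle eq_sym zx.
by move=> /(graded_lt gr); rewrite !rkB.
Qed.

Lemma card_core_chains (S : {set 'I_n}) :
  #|[pred t : #|S|.-tuple P | flag_chain rho S t & all (mem core) t]| =
  core_flagf S.
Proof.
have [g0 _ g1] := gr.
(* Flag ranks have the form i + 1 with i < n, so they avoid both 0 and n + 1, the ranks of the
   minimum and the maximum. *)
have inB t x : flag_chain rho S t -> x \in t -> x \in core -> x \in B.
  move=> /andP[_ /asboolP rt] xt; have := rt (rho x).
  rewrite map_f// => /esym/mapP[i _ rx].
  rewrite !inE -(graded_eq0 gr) -(graded_eq_top gr) rx /=.
  by rewrite eqSS (ltn_eqF (ltn_ord i)).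
rewrite /core_flagf; have [S0|Sn0] := eqVneq.
  rewrite -(@flagf_set0 _ P n rho) S0 flagfE; apply: eq_card => t; rewrite !inE.
  case: (flag_chain _ _ _) => //=.
  case: t => s /= /eqP; rewrite cards0 => /size0nil t0.
  by rewrite t0.
have [i0 i0S] := set0Pn _ Sn0.
case: fintype.subsetP => [S0|]; last first.
  move=> /fintype.subsetP/fintype.subsetPn[i iS]; rewrite inE => i_neq0.
  apply: eq_card0 => t; rewrite !inE; apply/negP => /andP[ct /allP tK].
  have /andP[_ /asboolP /(_ i.+1)] := ct.
  rewrite map_f ?mem_enum// => /mapP[x xt rx].
  by move: i_neq0; rewrite -eqSS rx (rkB (inB _ _ ct xt (tK _ xt))).
have S1 : S = [set i0]%SET.
  apply/setP => i; rewrite !inE; apply/idP/eqP => [iS|->//]; apply/val_inj.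
  by rewrite /= (eqP (S0 _ i0S)) (eqP (S0 _ iS)).
(* [#|S|] equals 1 only propositionally, so the one-point chain is written as a constant tuple. *)
pose f x : #|S|.-tuple P := [tuple of nseq #|S| x].
have fE x : val (f x) = [:: x] by rewrite /= S1 cards1.
have injf : injective f by move=> x y /(congr1 val); rewrite !fE => -[].
rewrite -cardB -(fintype.card_image injf); apply: eq_card => t; rewrite inE.
apply/andP/fintype.imageP => [[ct /allP tK]|[x xB ->]].
  have : size t = 1%N by rewrite size_tuple S1 cards1.
  case tE: (val t) => [|x []]// _; exists x; last by apply: val_inj; rewrite fE.
  have xt : x \in tval t by rewrite [tval t]tE inE.
  by rewrite (inB _ _ ct xt (tK _ xt)).
have rx : [seq rho z | z <- [:: x]] =i [seq (val i).+1 | i in S].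
  move=> a; rewrite /= rkB// inE; apply/eqP/mapP => [->|[i]].
    by exists i0; rewrite ?mem_enum// (eqP (S0 _ i0S)).
  by rewrite mem_enum => iS ->; rewrite (eqP (S0 _ iS)).
rewrite fE /flag_chain; split; first by rewrite (asboolT rx).
by rewrite /= !inE xB !orbT.
Qed.

End Core.

(** * From flag numbers to L-vectors *)

(** Toggling a fixed [e] of [B] outside [A] pairs the sets [C] with opposite signs. *)
Lemma sum_sign_interval (V : pzRingType) (T : finType) (A B : {set T}) :
  A \proper B ->
  \sum_(C : {set T} | (A \subset C) && (C \subset B)) (-1) ^+ #|C| = 0 :> V.
Proof.
move=> /properP[AB [e eB eA]]; rewrite (bigID (fun C : {set T} => e \in C)) /=.
rewrite (reindex_onto (fun C => e |: C)%SET (fun C => C :\ e)%SET) /=; last first.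
  by move=> C /andP[_ eC]; rewrite finset.setD1K.
rewrite -[X in X + _]opprK -sumrN addrC; apply/eqP; rewrite subr_eq0; apply/eqP.
apply: eq_big => C; last first.
  by move=> /andP[_ eC]; rewrite cardsU1 eC exprS mulN1r opprK.
rewrite setU11 andbT; case: (boolP (e \in C)) => eC /=; rewrite ?andbT ?andbF.
  apply/esym/negbTE; rewrite negb_and; apply/orP; right.
  by apply/eqP => /setP/(_ e); rewrite !inE eqxx eC.
rewrite finset.setU1K// eqxx andbT finset.subUset finset.sub1set eB /=; congr (_ && _).
apply/fintype.subsetP/fintype.subsetP => sA z zA; first by rewrite !inE sA ?orbT.
by have := sA z zA; rewrite !inE => /predU1P[ze|//]; rewrite -ze zA in eA.
Qed.

(** With U the complement of [Q], the coefficient of [b T] is the sum of (-1)^|U| over the subsets U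
    of [T], which vanishes unless [T] is empty. *)
Lemma sum_flagL_transform (V : pzRingType) n (b : {set 'I_n} -> V) :
  \sum_(Q : {set 'I_n})
    (-1) ^+ (n - #|Q|) * \sum_(T : {set 'I_n} | ~: Q \subset T) b T =
  b finset.set0.
Proof.
rewrite (reindex_inj (@finset.setC_inj _)) /=.
under eq_bigr => U _.
  rewrite finset.setCK -[n in (n - _)%N]card_ord -cardsCs mulr_sumr; over.
rewrite (exchange_big_dep xpredT)//= (bigD1 finset.set0)//=.
rewrite (big_pred1 finset.set0) => [|U]; last by rewrite finset.subset0.
rewrite cards0 mul1r big1 ?addr0// => T T0.
rewrite -mulr_suml.
rewrite (eq_bigl (fun U : {set _} => (finset.set0 \subset U) && (U \subset T))).
  by rewrite sum_sign_interval ?mul0r// finset.proper0.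
by move=> U; rewrite finset.sub0set.
Qed.

Lemma sum_flagL (R : realType) n {disp : Order.disp_t} {P : finTBPOrderType disp}
    (rho : P -> nat) :
  \sum_(Q : {set 'I_n}) flagL R rho Q = (flagf rho (finset.set0 : {set 'I_n}))%:R.
Proof. by rewrite sum_flagL_transform cards0 mul1r. Qed.

(** The vector c of the gluing argument: the transform of [flagL] applied to [core_flagf], hence
    dependent on [n] alone. *)
Definition core_flagL (R : realType) n (S : {set 'I_n}) : R :=
  (-1) ^+ (n - #|S|) *
  \sum_(T : {set 'I_n} | ~: S \subset T) (- 2^-1) ^+ #|T| * (core_flagf T)%:R.

(** The transform is linear in the flag numbers, so [flagf_glued] carries over coordinatewise. *)
Lemma flagL_glued (R : realType) {disp : Order.disp_t} {P : finTBPOrderType disp}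
    n (rho : P -> nat) (gr : graded rho n.+1) (B : {set P})
    (rkB : forall x, x \in B -> rho x = 1%N) (cardB : #|B| = (odd n).*2) N
    (S : {set 'I_n}) :
  flagL R (glued_rho (core gr rkB) N rho) S + N%:R * core_flagL R S =
  N.+1%:R * flagL R rho S.
Proof.
rewrite /flagL /core_flagL mulrCA [RHS]mulrCA -mulrDr; congr (_ * _).
rewrite !mulr_sumr -big_split /=; apply: eq_bigr => T _.
rewrite mulrCA -mulrDr [RHS]mulrCA -!natrM -natrD.
by rewrite -(card_core_chains gr rkB cardB) flagf_glued.
Qed.

(** * Boolean lattices as Eulerian posets of every positive rank *)

Section Boolean.
Context (n : nat).
Import Order.DefaultSetSubsetOrder.
Local Notation Bn := {set 'I_n.+1}.

Lemma ltEproper (A B : Bn) : (A < B)%O = (A \proper B).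
Proof. by rewrite lt_neqAle finset.properEneq. Qed.

Lemma subset_graded : graded (fun A : Bn => #|A|) n.+1.
Proof.
split; [exact: cards0 | | by rewrite cardsT card_ord] => B A.
rewrite /covers => /andP[BA /forallP nobetween].
have /properP[sBA [e eA eB]] : B \proper A by rewrite -ltEproper.
have [<-|neA] := eqVneq (e |: B)%SET A; first by rewrite cardsU1 eB.
have /negP[] := nobetween (e |: B : Bn)%SET.
rewrite !lt_neqAle neA /= [(_ <= _)%O]finset.subsetU1 andbT.
apply/andP; split; first by apply: contraNneq eB => ->; rewrite setU11.
by rewrite [(_ <= _)%O]finset.subUset finset.sub1set eA.
Qed.

Lemma subset_eulerian : eulerian (fun A : Bn => #|A|).
Proof.
apply/(eulerianP subset_graded) => A B AB; apply: sum_sign_interval.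
by rewrite -ltEproper.
Qed.

Lemma exists_eulerian : exists (disp : Order.disp_t) (P : finTBPOrderType disp)
  (rho : P -> nat), graded rho n.+1 /\ eulerian rho.
Proof.
exists _, Bn, (fun A : Bn => #|A|).
by split; [exact: subset_graded|exact: subset_eulerian].
Qed.

End Boolean.

(** * Facets of closed cones *)

Section Facets.
Import numFieldNormedType.Exports.
Local Open Scope classical_set_scope.

Lemma continuous_coord_comb (R : realType) m (c : 'I_m -> R) :
  continuous (fun v : 'rV[R]_m => \sum_i v ord0 i * c i).
Proof.
have -> : (fun v : 'rV[R]_m => \sum_i v ord0 i * c i) =
    \sum_i (fun v : 'rV[R]_m => v ord0 i * c i).
  by apply/funext => v; rewrite fct_sumE.
elim/big_ind: _ => [|f g cf cg|i _] v.
- exact: cst_continuous.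
- exact: continuousD (cf v) (cg v).
- have h1 : {for v, continuous (fun u : 'rV[R]_m => u ord0 i)}.
    by apply: coord_continuous.
  have h2 : {for v, continuous (fun u : 'rV[R]_m => c i)} by exact: cst_continuous.
  exact: continuousM h1 h2.
Qed.

Lemma linear_row_continuous (R : realType) m (l : {linear 'rV[R]_m -> R^o}) :
  continuous (l : 'rV[R]_m -> R).
Proof.
have -> : (l : 'rV[R]_m -> R) = fun v => \sum_i v ord0 i * l (delta_mx ord0 i).
  apply/funext => v; rewrite {1}[v]row_sum_delta linear_sum.
  by apply: eq_bigr => i _; rewrite linearZ.
exact: continuous_coord_comb.
Qed.

(** [U] is the common zero set of the coordinates of [v - projv U v], which are continuous in
    [v]. *)
Lemma vspace_closed (R : realType) m (U : {vspace 'rV[R]_m}) :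
  closed [set v | v \in U].
Proof.
pose g : 'End('rV[R]_m) := (\1 - projv U)%VF.
have gE v : g v = v - projv U v by rewrite add_lfunE opp_lfunE id_lfunE.
have -> : [set v | v \in U] = \bigcap_j [set v | g v ord0 j = 0].
  apply/seteqP; split => v /=.
    by move=> vU j _ /=; rewrite gE projv_id// subrr mxE.
  move=> gv; have /eqP : g v = 0 by apply/rowP => j; rewrite gv// mxE.
  rewrite gE subr_eq0 => /eqP ->; exact: memv_proj.
apply: closed_bigI => j _.
have -> : [set v | g v ord0 j = 0] =
    (fun v : 'rV[R]_m => \sum_i v ord0 i * g (delta_mx ord0 i) ord0 j) @^-1` [set 0].
  suff gsum v : g v ord0 j = \sum_i v ord0 i * g (delta_mx ord0 i) ord0 j.
    by apply/seteqP; split => v /=; rewrite gsum.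
  rewrite {1}[v]row_sum_delta linear_sum summxE.
  by apply: eq_bigr => i _; rewrite linearZ mxE.
apply: preimage_closed; last exact: closed_eq.
by move=> v _; exact: continuous_coord_comb.
Qed.

(** [G] may be infinite, so its span is taken as a containing subspace of least dimension;
    intersecting it with another containing subspace cannot make it smaller. *)
Lemma exists_span (R : realType) (V : vectType R) (G : set V) :
  exists U : {vspace V}, (forall x, G x -> x \in U) /\
    forall W : {vspace V}, (forall x, G x -> x \in W) -> (U <= W)%VS.
Proof.
pose p d := `[< exists2 U : {vspace V}, \dim U = d & forall x, G x -> x \in U >].
have pex : exists d, p d.
  exists (\dim {:V}); apply/asboolP; exists fullv => // x _; exact: memvf.
case: (ex_minnP pex) => d /asboolP[U dU GU] dmin; exists U; split=> // W GW.
have : p (\dim (U :&: W)).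
  by apply/asboolP; exists (U :&: W)%VS => // x Gx; rewrite memv_cap GU ?GW.
move=> /dmin; rewrite -dU => le_dim; apply/capv_idPl/eqP.
by rewrite eqEdim capvSl.
Qed.

Lemma closure_sub_closed (T : topologicalType) (A C : set T) :
  closed C -> A `<=` C -> closure A `<=` C.
Proof. by move=> cC AC; rewrite closureE => x; apply. Qed.

Lemma has_dim_span (R : realType) (V : vectType R) (A : set V) (U : {vspace V}) :
  A 0 -> (forall x, A x -> x \in U) ->
  (forall W : {vspace V}, (forall x, A x -> x \in W) -> (U <= W)%VS) ->
  has_dim A (\dim U).
Proof.
move=> A0 AU minU; exists 0, U; split=> // [x Ax|W AW]; first by rewrite subr0 AU.
by apply: minU => x /AW; rewrite subr0.
Qed.

Lemma cone_hull0 (R : realType) (V : lmodType R) (G : set V) : cone_hull G 0.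
Proof.
exists 0%N, (fun=> 0), (fun=> 0); split=> [//|[]//|].
by rewrite big_ord0.
Qed.

Lemma cone_hull_scale (R : realType) (V : lmodType R) (G : set V) (a : R) v :
  0 <= a -> G v -> cone_hull G (a *: v).
Proof. by exists 1%N, (fun=> a), (fun=> v); split=> //; rewrite big_ord1. Qed.

(* The hypotheses give w / (N + 1) = v - c + c / (N + 1), with limit v - c. *)
Lemma facet_of_gluing (R : realType) m (G : set 'rV[R]_m)
    (l : {linear 'rV[R]_m -> R^o}) (c : 'rV[R]_m) :
  (exists v, G v) -> (forall v, G v -> l v = 1) ->
  (forall v N, G v -> exists2 w, G w & w + N%:R *: c = N.+1%:R *: v) ->
  determines_facet (closure (cone_hull G)) l.
Proof.
move=> [v0 Gv0] lG glueG; set C := closure _.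
have GC v : G v -> C v.
  by move=> Gv; apply: subset_closure; rewrite -[v]scale1r; exact: cone_hull_scale.
have C0 : C 0 by apply: subset_closure; exact: cone_hull0.
(* For N = 1, applying [l] to the gluing identity gives 1 + l c = 2. *)
have lc : l c = 1.
  have [w Gw /(congr1 l)] := glueG v0 1%N Gv0.
  rewrite linearD !linearZ /= (lG w)// (lG v0)// => e; apply: (@addrI R 1).
  by move: e; rewrite /GRing.scale /= mul1r mulr1 mulr2n.
have Cnneg x : C x -> 0 <= l x.
  apply: (@closure_sub_closed _ _ [set x | 0 <= l x]).
    apply: (@preimage_closed _ _ (l : _ -> R) [set y | 0 <= y]).
      by move=> v _; exact: linear_row_continuous.
    exact: closed_ge.
  move=> _ [k [a [g [a_ge0 Gg ->]]]] /=; rewrite linear_sum sumr_ge0// => i _.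
  by rewrite linearZ /= lG// [X in 0 <= X]mulr1.
split=> //.
have CG v : G v -> C (v - c).
  move=> Gv; apply: (@closed_cvg _ _ \oo _ (fun N => v - c + @harmonic R N *: c) C).
  - exact: closed_closure.
  - apply: nearW => N; have [w Gw /(canRL (addrK _)) wE] := glueG v N Gv.
    apply: subset_closure.
    suff -> : v - c + harmonic N *: c = N.+1%:R^-1 *: w.
      by apply: cone_hull_scale => //; rewrite invr_ge0 ler0n.
    have NE : N%:R = N.+1%:R - 1 :> R by rewrite -natr1 addrK.
    rewrite wE NE scalerBr !scalerA mulrBr mulVf ?pnatr_eq0// mulr1.
    by rewrite scalerBl !scale1r opprB addrA addrAC.
  - rewrite -[X in _ --> X]addr0 -(scale0r c).
    apply: cvgD; first exact: cvg_cst.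
    by apply: cvgZr_tmp; exact: cvg_harmonic.
have [U [GU minU]] := exists_span G.
have CU x : C x -> x \in U.
  apply: (@closure_sub_closed _ _ [set x | x \in U]); first exact: vspace_closed.
  move=> _ [k [a [g [_ Gg ->]]]] /=; apply: rpred_sum => i _.
  by rewrite rpredZ ?GU.
pose f : 'Hom('rV[R]_m, R^o) := linfun l.
have fE v : f v = l v by rewrite lfunE.
have mem_ker v : (v \in lker f) = (l v == 0) by rewrite memv_ker fE.
(* [U] is the span of the cone, and its intersection with the kernel will be the span of the face.
   The dimension drops by exactly one because [l] is 1 at [v0]. *)
exists (\dim (U :&: lker f)); split.
  have <- : \dim U = (\dim (U :&: lker f)).+1.
    rewrite -(limg_ker_dim f U) -[RHS]addn1; congr (_ + _)%N; apply/eqP.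
    rewrite eqn_leq; apply/andP; split.
      by rewrite (leq_trans (dimvS (subvf _)))// dimvf.
    rewrite lt0n dimv_eq0; apply/eqP => fU0.
    have : f v0 \in (f @: U)%VS by rewrite memv_img ?GU.
    by rewrite fU0 memv0 fE lG// oner_eq0.
  apply: has_dim_span => // W CW; apply: minU => x /GC; exact: CW.
apply: has_dim_span.
- by split => //=; rewrite linear0.
- by move=> x [Cx lx]; rewrite memv_cap CU// mem_ker; apply/eqP.
move=> W FW.
have FW' v : G v -> v - c \in (W :&: lker f)%VS.
  move=> Gv; have lvc : l (v - c) = 0 by rewrite linearB /= lG// lc subrr.
  rewrite memv_cap; apply/andP; split; last by rewrite mem_ker lvc.
  by apply: FW; split; [exact: CG|exact: lvc].
(* Modulo [v0], each generator is a difference of two face points [v - c] and [v0 - c]. *)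
have UW : (U <= (W :&: lker f) + <[v0]>)%VS.
  apply: minU => v Gv.
  have -> : v = (v - c) - (v0 - c) + v0 by rewrite opprB addrA subrK subrK.
  by rewrite memv_add ?memv_line// rpredB ?FW'.
(* Write [v] as [w + k *: v0]; since [l] kills [v] and [w] and is 1 at [v0], the coefficient [k] is
   0. *)
apply/subvP => v; rewrite memv_cap mem_ker => /andP[/(subvP UW)/memv_addP[w]].
rewrite memv_cap mem_ker => /andP[wW lw] [_ /vlineP[k ->] ->].
rewrite linearD linearZ /= (eqP lw) lG// add0r [X in X == _]mulr1 => /eqP ->.
by rewrite scale0r addr0.
Qed.

End Facets.

Theorem proposition4p5 (R : realType) (n : nat) :
  determines_facet (eulerian_cone R n) (coord_sum R n) /\
  (forall (disp : Order.disp_t) (P : finTBPOrderType disp) (rho : P -> nat),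
     graded rho n.+1 ->
     \sum_(Q : {set 'I_n}) flagL R rho Q = (flagf rho (finset.set0 : {set 'I_n}))%:R).
Proof.
split; last by move=> disp P rho _; exact: sum_flagL.
(* The three goals left are a generator, the value 1 of the coordinate sum on generators, and the
   gluing identity. *)
apply: (@facet_of_gluing _ _ _ (coord_sum R n) (\row_i core_flagL R (enum_val i))).
- have [disp [P [rho [gr eu]]]] := exists_eulerian n.
  by exists (flagL_vec n rho), disp, P, rho.
- move=> _ [disp [P [rho [_ _ ->]]]].
  transitivity (\sum_(Q : {set 'I_n}) flagL R rho Q); last first.
    by rewrite sum_flagL flagf_set0.
  by apply: eq_bigr => Q _; rewrite mxE enum_rankK.
- move=> _ N [disp [P [rho [gr eu ->]]]].
  have [B [rkB cardB]] := exists_core gr eu.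
  exists (flagL_vec n (glued_rho (core gr rkB) N rho)).
    exists disp, (glued (core gr rkB) N), (glued_rho (core gr rkB) N rho); split => //.
      exact: glued_graded.
    apply: (glued_eulerian gr eu); exact: core_alternating cardB.
  by apply/rowP => i; rewrite !mxE flagL_glued.
Qed.
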